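(* Let $t_0$ be a (quantum) seed and $F\subset I_{\mathrm{uf}}$. Assume that $\tilde B(t_0)$ is of full rank, that $\mathcal U(t_0)$ has a $\Bbbk$-basis $\mathcal Z=\{z_g\mid g\in\mathbb Z^I\}$ with each $z_g$ being $g$-pointed in $\mathcal{LP}(t_0)$, and that $\{\mathfrak f_{F,g}z_g\mid g\in\mathbb Z^I\}$ is a $\Bbbk$-basis of $\mathcal U(\mathfrak f_Ft_0)$. Then the following holds: if $\mathcal S=\{s_g\mid g\in\mathbb Z^I\}$ is a $\Bbbk$-basis of $\mathcal U(t_0)$ such that each $s_g$ is $g$-pointed, then $\{\mathfrak f_{F,g}s_g\mid g\in\mathbb Z^I\}$ is a $\Bbbk$-basis of $\mathcal U(\mathfrak f_Ft_0)$.
   Context: Base ring: in the classical case $\Bbbk=\mathbb Z$ and $v=1$; in the quantum case $\Bbbk=\mathbb Z[v^{\pm1}]$ with $v$ an indeterminate. $\mathbb N=\{0,1,2,\dots\}$, $[a]_+=\max(a,0)$. Seeds. A seed $t$ consists of a finite set $I=I_{\mathrm{uf}}\sqcup I_{\mathrm f}$ (unfrozen and frozen vertices), positive integers $(d_i)_{i\in I}$, a rational matrix $(b_{ij})_{i,j\in I}$ with $d_i^\vee b_{ij}=-d_j^\vee b_{ji}$ (where $d_i^\vee=\mathrm{lcm}(d_j)_{j\in I}/d_i$) and $b_{ij}\in\mathbb Z$ whenever $i\in I_{\mathrm{uf}}$ or $j\in I_{\mathrm{uf}}$, and indeterminates $(x_i)_{i\in I}$. Put $\tilde B=(b_{ik})_{i\in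 I,k\in I_{\mathrm{uf}}}$. Let $f_i$ ($i\in I$), $e_k$ ($k\in I_{\mathrm{uf}}$) be the unit vectors of $\mathbb Z^I$, $\mathbb Z^{I_{\mathrm{uf}}}$, and $p^*:\mathbb Z^{I_{\mathrm{uf}}}\to\mathbb Z^I$ the linear map $p^*e_k=\sum_i b_{ik}f_i$ (injective if $\tilde B$ has full rank). A quantum seed is a seed with a $\mathbb Z$-valued skew-symmetric bilinear form $\lambda$ on $\mathbb Z^I$ such that $\lambda(f_i,p^*e_k)=\delta_{ik}\mathbf d_k$ for some strictly positive integers $\mathbf d_k$. Laurent polynomials. $\mathcal{LP}(t)=\bigoplus_{m\in\mathbb Z^I}\Bbbk x^m$ with $x_i=x^{f_i}$ and multiplication $x^g*x^h=v^{\lambda(g,h)}x^{g+h}$ (the usual product in the classical case). Mutation at $k\in I_{\mathrm{uf}}$: $t'=\mu_kt$ has the same $I,I_{\mathrm{uf}},d_i$; $b'_{ij}=-b_{ij}$ if $k\in\{i,j\}$, and $b'_{ij}=b_{ij}+[b_{ik}]_+[b_{kj}]_+-[-b_{ik}]_+[-b_{kj}]_+$ otherwise; $x'_i=x_i$ for $i\ne k$ and $x_k'=x^{-f_k+\sum_i[b_{ik}]_+f_i}+x^{-f_k+\sum_i[-b_{ik}]_+f_i}$; in the quantum case $\lambda'(f_i,f_j)=\lambda(g_i,g_j)$ with $g_i=f_i$ for $i\neq k$ and $g_k=-f_k+\sum_i[-b_{ik}]_+f_i$. The (skew-)fields of fractions of $\mathcal{LP}(t')$ and $\mathcal{LP}(t)$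 are identified accordingly. $\Delta^+_{t_0}$ is the set of all seeds obtained from $t_0$ by finite sequences of mutations at unfrozen vertices. The upper cluster algebra is $\mathcal U(t_0)=\bigcap_{t\in\Delta_{t_0}^+}\mathcal{LP}(t)$. Pointedness. An element $z\in\mathcal{LP}(t_0)$ is $g$-pointed ($g\in\mathbb Z^I$) if $z=\sum_{n\in\mathbb N^{I_{\mathrm{uf}}}}c_nx^{g+p^*n}$ with $c_n\in\Bbbk$ and $c_0=1$. Freezing. $\mathfrak f_Ft_0$ is the seed with the same data as $t_0$ (the same $\lambda$ in the quantum case), except that its set of unfrozen vertices is $I_{\mathrm{uf}}\setminus F$ and its set of frozen vertices is $I_{\mathrm f}\sqcup F$; as algebras $\mathcal{LP}(\mathfrak f_Ft_0)=\mathcal{LP}(t_0)$. The freezing operator $\mathfrak f_{F,g}$ sends $\sum_{n\in\mathbb N^{I_{\mathrm{uf}}}}c_nx^{g+p^*n}$ to $\sum_{n:\ \mathrm{supp}\,n\cap F=\emptyset}c_nx^{g+p^*n}$, where $\mathrm{supp}\,n=\{k: n_k\neq0\}$. *)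

(* Defs.v *)
From HB Require Import structures.
From mathcomp Require Import all_boot all_order all_algebra finmap.
From mathcomp Require Import monalg.
From mathcomp Require Import boolp.

Set Implicit Arguments.
Unset Strict Implicit.
Unset Printing Implicit Defensive.

Import Order.TTheory GRing.Theory Num.Theory.

Local Open Scope ring_scope.

(* Twisted group algebras: R-linear combinations of formal symbols x^g with
   x^g * x^h = c(g, h) x^(g+h).  The product of monalg.v does not apply, its
   exponents form a monoid without nontrivial units.                          *)

Record cocycle (R : comNzRingType) (G : zmodType) := Cocycle {
  cocycle_fun :> G -> G -> R;
  cocycle0g : forall g, cocycle_fun 0 g = 1;
  cocycleg0 : forall g, cocycle_fun g 0 = 1;
  cocycleA : forall g h k,
    cocycle_fun h k * cocycle_fun g (h + k)
    = cocycle_fun g h * cocycle_fun (g + h) k }.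

Definition twisted (R : comNzRingType) (G : zmodType) (c : cocycle R G) : Type :=
  {malg R[G]}.

HB.instance Definition _ (R : comNzRingType) (G : zmodType) (c : cocycle R G) :=
  GRing.Lmodule.on (twisted c).

Section Twisted.

Variables (R : comNzRingType) (G : zmodType) (c : cocycle R G).

Implicit Types (p q : twisted c).

Definition twmul p q : twisted c :=
  \sum_(g <- msupp p) \sum_(h <- msupp q) << p@_g * q@_h * c g h *g g + h >>.

Lemma twmulw (d1 d2 : {fset G}) p q : (msupp p `<=` d1)%fset -> (msupp q `<=` d2)%fset ->
  twmul p q =
    \sum_(g <- d1) \sum_(h <- d2) << p@_g * q@_h * c g h *g g + h >>.
Proof.
move=> le1 le2; rewrite /twmul (big_fset_incl _ le1) /=.
  apply/eq_bigr=> g _; apply/big_fset_incl => // h _ /mcoeff_outdom ->.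
  by rewrite mulr0 mul0r monalgU0.
move=> g _ /mcoeff_outdom pg.
by rewrite big1 => // h _; rewrite pg !mul0r monalgU0.
Qed.

Lemma twmulDl : left_distributive twmul +%R.
Proof.
move=> p1 p2 q.
rewrite (twmulw (msuppD_le p1 p2) (fsubset_refl _)).
rewrite [twmul p1 q](twmulw (fsubsetUl _ (msupp p2)) (fsubset_refl _)).
rewrite [twmul p2 q](twmulw (fsubsetUr (msupp p1) _) (fsubset_refl _)).
rewrite -big_split /=; apply/eq_bigr=> g _.
rewrite -big_split /=; apply/eq_bigr=> h _.
by rewrite mcoeffD !mulrDl monalgUD.
Qed.

Lemma twmulDr : right_distributive twmul +%R.
Proof.
move=> p q1 q2.
rewrite (twmulw (fsubset_refl _) (msuppD_le q1 q2)).
rewrite [twmul p q1](twmulw (fsubset_refl _) (fsubsetUl _ (msupp q2))).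
rewrite [twmul p q2](twmulw (fsubset_refl _) (fsubsetUr (msupp q1) _)).
rewrite -big_split /=; apply/eq_bigr=> g _.
rewrite -big_split /=; apply/eq_bigr=> h _.
by rewrite mcoeffD mulrDr mulrDl monalgUD.
Qed.

Lemma twmul0p : left_zero 0 twmul.
Proof. by move=> p; rewrite /twmul msupp0 big_seq_fset0. Qed.

Lemma twmulp0 : right_zero 0 twmul.
Proof.
by move=> p; rewrite /twmul big1 // => g _; rewrite msupp0 big_seq_fset0.
Qed.

Lemma twmulUU (a b : R) (g h : G) :
  twmul << a *g g >> << b *g h >> = << a * b * c g h *g g + h >>.
Proof. by rewrite (twmulw msuppU_le msuppU_le) !big_seq_fset1 !mcoeffUU. Qed.

Lemma twmul_suml I (r : seq I) (f : I -> twisted c) q :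
  twmul (\sum_(i <- r) f i) q = \sum_(i <- r) twmul (f i) q.
Proof.
exact: (big_morph (twmul^~ q) (fun _ _ => twmulDl _ _ _) (twmul0p q)).
Qed.

Lemma twmul_sumr I (r : seq I) (f : I -> twisted c) p :
  twmul p (\sum_(i <- r) f i) = \sum_(i <- r) twmul p (f i).
Proof.
exact: (big_morph (twmul p) (fun _ _ => twmulDr _ _ _) (twmulp0 p)).
Qed.

Lemma twisted_ind (P : twisted c -> Prop) :
    P 0 -> (forall p q, P p -> P q -> P (p + q)) ->
  (forall a g, P << a *g g >>) -> forall p, P p.
Proof. by move=> P0 PD PU p; rewrite (monalgE p); apply: big_ind. Qed.

Lemma twmulA : associative twmul.
Proof.
move=> p q r.
elim/twisted_ind: p => [|p1 p2 IH1 IH2|a g]; first by rewrite !twmul0p.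
  by rewrite !twmulDl IH1 IH2.
elim/twisted_ind: q => [|q1 q2 IH1 IH2|b h].
- by rewrite twmul0p twmulp0 twmul0p.
- by rewrite twmulDl !twmulDr twmulDl IH1 IH2.
elim/twisted_ind: r => [|r1 r2 IH1 IH2|e k]; first by rewrite !twmulp0.
  by rewrite !twmulDr IH1 IH2.
rewrite !twmulUU addrA; congr (mkmalgU _ _).
by rewrite !mulrA -mulrA cocycleA mulrA [_ * e * _]mulrAC.
Qed.

Definition twone : twisted c := << 1 *g 0 >>.

Lemma twmul1p : left_id twone twmul.
Proof.
elim/twisted_ind => [|p1 p2 IH1 IH2|a g]; first by rewrite twmulp0.
  by rewrite twmulDr IH1 IH2.
by rewrite twmulUU cocycle0g mulr1 mul1r add0r.
Qed.

Lemma twmulp1 : right_id twone twmul.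
Proof.
elim/twisted_ind => [|p1 p2 IH1 IH2|a g]; first by rewrite twmul0p.
  by rewrite twmulDl IH1 IH2.
by rewrite twmulUU cocycleg0 !mulr1 addr0.
Qed.

Lemma twone_neq0 : twone != 0.
Proof. by rewrite monalgU_eq0 oner_eq0. Qed.

HB.instance Definition _ := GRing.Zmodule_isNzRing.Build (twisted c)
  twmulA twmul1p twmulp1 twmulDl twmulDr twone_neq0.

Lemma scale_twistedU (a b : R) (g : G) :
  a *: (<< b *g g >> : twisted c) = << a * b *g g >>.
Proof. by apply/malgP=> k; rewrite mcoeffZ !mcoeffU mulrnAr. Qed.

Lemma mul_twistedU (a b : R) (g h : G) :
  (<< a *g g >> : twisted c) * << b *g h >> = << a * b * c g h *g g + h >>.
Proof. exact: twmulUU. Qed.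

Lemma twscaleAl (a : R) p q : a *: (p * q) = a *: p * q.
Proof.
elim/twisted_ind: p => [|p1 p2 IH1 IH2|b g].
- by rewrite mul0r scaler0 mul0r.
- by rewrite mulrDl !scalerDr mulrDl IH1 IH2.
elim/twisted_ind: q => [|q1 q2 IH1 IH2|b' h].
- by rewrite !mulr0 scaler0.
- by rewrite !mulrDr scalerDr IH1 IH2.
by rewrite scale_twistedU !mul_twistedU scale_twistedU !mulrA.
Qed.

HB.instance Definition _ :=
  GRing.Lmodule_isLalgebra.Build R (twisted c) twscaleAl.

Lemma twscaleAr (a : R) p q : a *: (p * q) = p * (a *: q).
Proof.
elim/twisted_ind: p => [|p1 p2 IH1 IH2|b g].
- by rewrite !mul0r scaler0.
- by rewrite !mulrDl scalerDr IH1 IH2.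
elim/twisted_ind: q => [|q1 q2 IH1 IH2|b' h].
- by rewrite mulr0 scaler0 mulr0.
- by rewrite mulrDr !scalerDr mulrDr IH1 IH2.
by rewrite scale_twistedU !mul_twistedU scale_twistedU !mulrA [b * a]mulrC.
Qed.

HB.instance Definition _ :=
  GRing.Lalgebra_isAlgebra.Build R (twisted c) twscaleAr.

End Twisted.

Definition cocycle1 (R : comNzRingType) (G : zmodType) : cocycle R G :=
  @Cocycle R G (fun _ _ => 1) (fun _ => erefl) (fun _ => erefl)
    (fun _ _ _ => erefl).

Definition laurent : Type := twisted (cocycle1 int int).

HB.instance Definition _ := GRing.NzRing.on laurent.

Lemma laurent_mulC : @commutative laurent laurent *%R.
Proof.
move=> p q.
elim/twisted_ind: p => [|p1 p2 IH1 IH2|a g]; first by rewrite mulr0 mul0r.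
  by rewrite mulrDl mulrDr IH1 IH2.
elim/twisted_ind: q => [|q1 q2 IH1 IH2|b h]; first by rewrite mulr0 mul0r.
  by rewrite mulrDl mulrDr IH1 IH2.
by rewrite !mul_twistedU addrC [a * b]mulrC.
Qed.

HB.instance Definition _ :=
  GRing.PzRing_hasCommutativeMul.Build laurent laurent_mulC.

Inductive flavour := Classical | Quantum.

Definition base (q : flavour) : comNzRingType :=
  match q with Classical => int | Quantum => laurent end.

Definition vpow (q : flavour) (n : int) : base q :=
  match q with Classical => 1 | Quantum => (<< 1 *g n >> : laurent) end.

Lemma vpow0 q : vpow q 0 = 1.
Proof. by case: q. Qed.

Lemma vpowD q m n : vpow q (m + n) = vpow q m * vpow q n.
Proof.
case: q => /=; first by rewrite mulr1.
by rewrite [RHS]mul_twistedU !mulr1.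
Qed.

Section Seeds.

Variable I : finType.

(* b and form are the matrices (b_ij) and (lambda(f_i, f_j)). *)
Record seed := Seed {
  uf : {set I};
  dd : I -> nat;
  bb : I -> I -> rat;
  form : I -> I -> int }.

Definition unitv (i : I) : {ffun I -> int} := [ffun j => (j == i)%:R].

Definition bilin (L : I -> I -> int) (g h : {ffun I -> int}) : int :=
  \sum_i \sum_j g i * h j * L i j.

Implicit Types (t : seed) (q : flavour).

(* floor is only used on entries b_ij that are integers, where it is exact. *)
Definition bint t (i j : I) : int := Num.floor (bb t i j).

Definition ufT t : finType := {k : I | k \in uf t}.

Definition pstar t (n : {ffun ufT t -> int}) : {ffun I -> int} :=
  \sum_(k : ufT t) (\sum_i unitv i *~ bint t i (val k)) *~ n k.

Definition unitu t (k : ufT t) : {ffun ufT t -> int} := [ffun l => (l == k)%:R].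

Definition dvee t (i : I) : nat := (\big[lcmn/1]_j dd t j %/ dd t i)%N.

Definition is_seed t : Prop :=
  [/\ forall i, (0 < dd t i)%N,
      forall i j, (dvee t i)%:R * bb t i j = - ((dvee t j)%:R * bb t j i)
    & forall i j, (i \in uf t) || (j \in uf t) -> bb t i j \is a Num.int].

Definition compatible t : Prop :=
  (forall i j, form t i j = - form t j i) /\
  (exists delta : ufT t -> int, (forall k, 0 < delta k) /\
     forall (i : I) (k : ufT t),
       bilin (form t) (unitv i) (pstar (unitu k)) =
       if i == val k then delta k else 0).

(* A classical seed carries no form; it is encoded by the zero form. *)
Definition valid_seed q t : Prop :=
  is_seed t /\
  match q with
  | Classical => forall i j, form t i j = 0
  | Quantum => compatible t
  end.

Definition Btilde t : 'M[rat]_(#|I|, #|uf t|) :=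
  \matrix_(i, k) bb t (enum_val i) (enum_val k).

Definition full_rank t : Prop := \rank (Btilde t) = #|uf t|.

Lemma bilin0g L g : bilin L 0 g = 0.
Proof.
by rewrite /bilin big1 // => i _; rewrite big1 // => j _; rewrite ffunE !mul0r.
Qed.

Lemma biling0 L g : bilin L g 0 = 0.
Proof.
rewrite /bilin big1 // => i _; rewrite big1 // => j _.
by rewrite ffunE mulr0 mul0r.
Qed.

Lemma bilinDl L g1 g2 h : bilin L (g1 + g2) h = bilin L g1 h + bilin L g2 h.
Proof.
rewrite -big_split /=; apply/eq_bigr => i _.
rewrite -big_split /=; apply/eq_bigr => j _.
by rewrite ffunE !mulrDl.
Qed.

Lemma bilinDr L g h1 h2 : bilin L g (h1 + h2) = bilin L g h1 + bilin L g h2.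
Proof.
rewrite -big_split /=; apply/eq_bigr => i _.
rewrite -big_split /=; apply/eq_bigr => j _.
by rewrite ffunE mulrDr mulrDl.
Qed.

Definition vform q (L : I -> I -> int) (g h : {ffun I -> int}) : base q :=
  vpow q (bilin L g h).

Lemma vform0g q L g : vform q L 0 g = 1.
Proof. by rewrite /vform bilin0g vpow0. Qed.

Lemma vformg0 q L g : vform q L g 0 = 1.
Proof. by rewrite /vform biling0 vpow0. Qed.

Lemma vformA q L g h k :
  vform q L h k * vform q L g (h + k) = vform q L g h * vform q L (g + h) k.
Proof.
rewrite /vform -!vpowD bilinDl bilinDr; congr vpow.
by rewrite addrC -addrA.
Qed.

Definition vcocycle q (L : I -> I -> int) : cocycle (base q) {ffun I -> int} :=
  Cocycle (vform0g q L) (vformg0 q L) (@vformA q L).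

Definition LP q t := twisted (vcocycle q (form t)).

Definition xpow q t (m : {ffun I -> int}) : LP q t := << 1 *g m >>.

Definition pos (R : realDomainType) (a : R) : R := Num.max a 0.

Definition gmut t (k i : I) : {ffun I -> int} :=
  if i == k then - unitv k + \sum_j unitv j *~ pos (- bint t j k) else unitv i.

Definition mutate (k : I) t : seed := {|
  uf := uf t;
  dd := dd t;
  bb := fun i j =>
    if (i == k) || (j == k) then - bb t i j
    else bb t i j + pos (bb t i k) * pos (bb t k j)
                  - pos (- bb t i k) * pos (- bb t k j);
  form := fun i j => bilin (form t) (gmut t k i) (gmut t k j) |}.

Section Clusters.

Variables (q : flavour) (K : unitAlgType (base q)).

Implicit Type x : I -> K.

(* The monomial x^m of LP(t), computed in an algebra K that contains elements
   x_i with x_i x_j = v^(2 lambda(f_i, f_j)) x_j x_i: from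
   x^g * x^h = v^lambda(g, h) x^(g+h), the product of the x_i^(m_i) in the order
   of the enumeration of I is
   v^(\sum_(i before j) m_i m_j lambda(f_i, f_j)) x^m.                        *)
Definition cmonomial t x (m : {ffun I -> int}) : K :=
  vpow q (- \sum_i \sum_(j | (enum_rank i < enum_rank j)%N)
              m i * m j * form t i j)
  *: \prod_i x i ^ m i.

Definition mutate_cluster (k : I) t x (i : I) : K :=
  if i == k then
    cmonomial t x (- unitv k + \sum_j unitv j *~ pos (bint t j k))
    + cmonomial t x (- unitv k + \sum_j unitv j *~ pos (- bint t j k))
  else x i.

Inductive reachable t0 x0 : seed -> (I -> K) -> Prop :=
  | reachable_refl : reachable t0 x0 t0 x0
  | reachable_mutate t x k : reachable t0 x0 t x -> k \in uf t ->
      reachable t0 x0 (mutate k t) (mutate_cluster k t x).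

(* LP(t) inside K: the base-linear span of the monomials of the seed (t, x). *)
Definition in_LP t x (z : K) : Prop :=
  exists p : LP q t, z = \sum_(m <- msupp p) p@_m *: cmonomial t x m.

End Clusters.

(* iota realizes K as a (skew-)field of fractions of the Ore domain LP(t).
   Such a K is unique up to a unique isomorphism over LP(t).                  *)
Definition is_fraction_field q t (K : unitAlgType (base q))
    (iota : {lrmorphism LP q t -> K}) : Prop :=
  [/\ forall a : K, a != 0 -> a \is a GRing.unit,
      injective iota
    & forall a : K, exists p s : LP q t, s != 0 /\ a = iota p * (iota s)^-1].

Definition init_cluster q t (K : unitAlgType (base q))
    (iota : {lrmorphism LP q t -> K}) (i : I) : K :=
  iota (xpow q t (unitv i)).

Definition upper_cluster_algebra q t0 (K : unitAlgType (base q))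
    (iota : {lrmorphism LP q t0 -> K}) (z : K) : Prop :=
  forall t x, reachable t0 (init_cluster iota) t x -> in_LP t x z.

Lemma ffun_mulz (g : {ffun I -> int}) n i : (g *~ n) i = g i * n.
Proof.
elim/int_ind: n => [|n IH|n IH]; first by rewrite mulr0z ffunE mulr0.
  by rewrite intS mulrzDr mulr1z ffunE IH mulrDr mulr1.
by rewrite intS opprD mulrzDr mulrN1z !ffunE IH mulrDr mulrN1.
Qed.

Lemma sum_unitv (m : {ffun I -> int}) : \sum_i unitv i *~ m i = m.
Proof.
apply/ffunP=> j; rewrite sum_ffunE (bigD1 j) //= ffun_mulz ffunE eqxx mul1r.
by rewrite big1 ?addr0 // => i /negPf ij; rewrite ffun_mulz ffunE eq_sym ij mul0r.
Qed.

Lemma bilin_unitvl L i h n : bilin L (unitv i *~ n) h = \sum_j n * h j * L i j.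
Proof.
rewrite /bilin (bigD1 i) //= [X in _ + X]big1 ?addr0 => [|k /negPf ki].
  by apply/eq_bigr=> j _; rewrite ffun_mulz ffunE eqxx mul1r.
by rewrite big1 // => j _; rewrite ffun_mulz ffunE ki !mul0r.
Qed.

Lemma xpowM q t g h :
  xpow q t g * xpow q t h = vform q (form t) g h *: xpow q t (g + h).
Proof. by rewrite mul_twistedU scale_twistedU !mulr1 mul1r. Qed.

Lemma valid_form_diag q t i : valid_seed q t -> form t i i = 0.
Proof.
case: q => -[_ /=]; first exact.
by case=> /(_ i i) /eqP; rewrite eq_sym eqNr => /eqP.
Qed.

Lemma xpow_unitvX q t (K : unitAlgType (base q))
    (iota : {lrmorphism LP q t -> K}) i n :
  valid_seed q t ->
  iota (xpow q t (unitv i)) ^ n = iota (xpow q t (unitv i *~ n)).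
Proof.
move=> /(valid_form_diag i) fii.
have xM a b : xpow q t (unitv i *~ a) * xpow q t (unitv i *~ b)
              = xpow q t (unitv i *~ (a + b)).
  rewrite xpowM /vform bilin_unitvl big1 ?vpow0 ?scale1r ?mulrzDr // => j _.
  rewrite ffun_mulz ffunE; case: eqP => [->|_]; last by rewrite mul0r mulr0 mul0r.
  by rewrite fii mulr0.
have x0 : xpow q t (unitv i *~ 0) = 1 by rewrite mulr0z.
have nE (k : nat) : iota (xpow q t (unitv i)) ^+ k = iota (xpow q t (unitv i *~ k)).
  elim: k => [|k IH]; first by rewrite x0 rmorph1.
  by rewrite exprS IH -{1}[unitv i]mulr1z -rmorphM /= xM -intS.
case: n => k; first exact: nE.
rewrite NegzE; rewrite -exprnN nE.
have xV : iota (xpow q t (unitv i *~ - k.+1%:Z)) * iota (xpow q t (unitv i *~ k.+1%:Z)) = 1.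
  by rewrite -rmorphM /= xM addNr x0 rmorph1.
have Vx : iota (xpow q t (unitv i *~ k.+1%:Z)) * iota (xpow q t (unitv i *~ - k.+1%:Z)) = 1.
  by rewrite -rmorphM /= xM subrr x0 rmorph1.
have U : iota (xpow q t (unitv i *~ k.+1%:Z)) \is a GRing.unit.
  by apply/unitrP; exists (iota (xpow q t (unitv i *~ - k.+1%:Z))).
by rewrite -[LHS]mulr1 -Vx mulKr.
Qed.

Lemma prod_init q t (K : unitAlgType (base q))
    (iota : {lrmorphism LP q t -> K}) (m : {ffun I -> int}) (r : seq I) :
  valid_seed q t -> pairwise (fun i j => (enum_rank i < enum_rank j)%N) r ->
  \prod_(i <- r) init_cluster iota i ^ m i =
  vpow q (\sum_(i <- r) \sum_(j <- r | (enum_rank i < enum_rank j)%N)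
            m i * m j * form t i j)
  *: iota (xpow q t (\sum_(i <- r) unitv i *~ m i)).
Proof.
move=> vt; elim: r => [|i r IH] /=.
  by rewrite !big_nil vpow0 scale1r rmorph1.
move=> /andP[/allP lt_ir /IH {}IH]; rewrite !big_cons {}IH ltnn.
rewrite /init_cluster xpow_unitvX // -scalerAr -rmorphM /= xpowM.
rewrite linearZ /= scalerA /vform -vpowD; congr (vpow q _ *: _).
rewrite [RHS]addrC; congr (_ + _).
  apply: eq_big_seq => j /lt_ir ij.
  by rewrite big_cons ltnNge (ltnW ij).
rewrite bilin_unitvl [RHS]big_seq_cond.
rewrite (eq_bigl (fun j => j \in r)) => [|j]; last first.
  by case: (boolP (j \in r)) => // /lt_ir ->.
rewrite -big_seq.
under [LHS]eq_bigr => j _ do rewrite sum_ffunE mulr_sumr mulr_suml.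
rewrite exchange_big /=; apply: eq_bigr => j _.
rewrite (bigD1 j) //= ffun_mulz ffunE eqxx mul1r big1 ?addr0 // => l /negPf lj.
by rewrite ffun_mulz ffunE lj mul0r mulr0 mul0r.
Qed.

(* In the initial cluster, cmonomial is the monomial of LP(t). *)
Lemma cmonomial_init q t (K : unitAlgType (base q))
    (iota : {lrmorphism LP q t -> K}) (m : {ffun I -> int}) :
  valid_seed q t -> cmonomial t (init_cluster iota) m = iota (xpow q t m).
Proof.
move=> vt; rewrite /cmonomial (prod_init iota m vt); last first.
  case E : (index_enum I) => [//|i0 r0]; rewrite -{}E.
  have -> : index_enum I = enum I by rewrite enumT [index_enum _]unlock.
  apply/(pairwiseP i0) => a b; rewrite !inE => la lb ab.
  have rk k : (k < size (enum I))%N -> enum_rank (nth i0 (enum I) k) = k :> nat.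
    move=> lk; have lk' : (k < #|I|)%N by rewrite cardE.
    by rewrite -[k in LHS]/(val (Ordinal lk')) -enum_val_nth enum_valK.
  by rewrite !rk.
by rewrite sum_unitv scalerA -vpowD addNr vpow0 scale1r.
Qed.

Definition natv t (n : {ffun ufT t -> nat}) : {ffun ufT t -> int} :=
  [ffun k => (n k)%:Z].

Definition expansion q t (g : {ffun I -> int})
    (c : {malg base q[{ffun ufT t -> nat}]}) : LP q t :=
  \sum_(n <- msupp c) c@_n *: xpow q t (g + pstar (natv n)).

Definition pointed q t (g : {ffun I -> int}) (z : LP q t) : Prop :=
  exists c : {malg base q[{ffun ufT t -> nat}]}, c@_0 = 1 /\ z = expansion g c.

Definition freeze_seed (F : {set I}) t : seed := {|
  uf := uf t :\: F; dd := dd t; bb := bb t; form := form t |}.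

Definition avoids t (F : {set I}) (n : {ffun ufT t -> nat}) : bool :=
  [forall k, (n k != 0%N) ==> (val k \notin F)].

(* Since p^* is injective, z determines the coefficients c_n; see
   freeze_expansion below.                                                    *)
Definition freeze q t (F : {set I}) (g : {ffun I -> int}) (z : LP q t) :
    LP q t :=
  \sum_(m <- msupp z |
        `[< exists2 n : {ffun ufT t -> nat},
              avoids F n & m = g + pstar (natv n) >])
    z@_m *: xpow q t m.

Lemma mcoeff_freeze q t (F : {set I}) g (z : LP q t) m :
  (freeze F g z)@_m =
  if `[< exists2 n : {ffun ufT t -> nat},
           avoids F n & m = g + pstar (natv n) >] then z@_m else 0.
Proof.
have xE (a : base q) k : (a *: xpow q t k)@_m = a *+ (k == m).
  by rewrite mcoeffZ mcoeffU mulrnAr mulr1.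
rewrite /freeze raddf_sum /= (eq_bigr _ (fun k _ => xE _ k)).
rewrite big_mkcond /=; case: (msuppP z m) => [zm|/[dup] zm /mcoeff_outdom zm0].
  rewrite (big_fsetD1 m) //= eqxx mulr1n big1_fset ?addr0 // => k.
  by rewrite in_fsetD1 => /andP[/negPf-> _] _; case: ifP.
rewrite if_same big1_fset // => k kz _; case: ifP => // _.
by case: eqP kz zm => // -> ->.
Qed.

Lemma freeze_expansion q t (F : {set I}) g
    (c : {malg base q[{ffun ufT t -> nat}]}) :
    injective (fun n : {ffun ufT t -> nat} => pstar (natv n)) ->
  freeze F g (expansion g c) =
  \sum_(n <- msupp c | avoids F n) c@_n *: xpow q t (g + pstar (natv n)).
Proof.
move=> inj_p; apply/malgP=> m; rewrite mcoeff_freeze.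
have xE (a : base q) k : (a *: xpow q t k)@_m = a *+ (k == m).
  by rewrite mcoeffZ mcoeffU mulrnAr mulr1.
rewrite /expansion !raddf_sum /= !(eq_bigr _ (fun k _ => xE _ _)).
rewrite [RHS]big_mkcond /=; case: asboolP => [[n avn ->]|nex].
  apply/eq_bigr => k _; case: (k =P n) => [->|/eqP nkn]; first by rewrite avn.
  rewrite (negPf (_ : _ != _)) ?if_same //.
  by apply: contra nkn => /eqP/addrI/inj_p->.
rewrite big1 // => k _; case: ifP => // avk.
by case: eqP => // km; case: nex; exists k.
Qed.

End Seeds.

Definition is_basis (R : nzRingType) (V : lmodType R) (J : choiceType)
    (U : V -> Prop) (s : J -> V) : Prop :=
  (forall a : {malg R[J]}, \sum_(j <- msupp a) a@_j *: s j = 0 -> a = 0) /\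
  (forall u, U u <-> exists a : {malg R[J]}, u = \sum_(j <- msupp a) a@_j *: s j).

(* Main.v *)
Require Import Defs.
From HB Require Import structures.
From mathcomp Require Import all_boot all_order all_algebra finmap.
From mathcomp Require Import monalg boolp.

(** Pointedness makes the expansion of one pointed basis in another triangular:
    if [z_g = sum_h a_h s_h], then every [h] with [a_h <> 0] lies in
    [g + p^* N^uf].  Applying [f_(F,g)] kills the terms with
    [h = g + p^* n] where [n] meets [F] and turns the other [s_h] into
    [f_(F,h) s_h], because [n + n'] avoids [F] iff both [n] and [n'] do.  Hence
    the frozen families of [z] and [s] have the same span; the frozen [s_g] are
    linearly independent because they are still pointed. *)

Set Implicit Arguments.
Unset Strict Implicit.
Unset Printing Implicit Defensive.

Import Order.TTheory GRing.Theory Num.Theory.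

Local Open Scope ring_scope.

Section Span.

Variables (R : nzRingType) (V : lmodType R) (J : choiceType).

Implicit Types (a b : {malg R[J]}) (s : J -> V).

Definition lincomb s a : V := \sum_(j <- msupp a) a@_j *: s j.

Definition in_span s (u : V) : Prop := exists a, u = lincomb s a.

Lemma lincombw s a (d : {fset J}) : (msupp a `<=` d)%fset ->
  lincomb s a = \sum_(j <- d) a@_j *: s j.
Proof.
by move=> le; apply: big_fset_incl => // j _ /mcoeff_outdom ->; rewrite scale0r.
Qed.

Lemma lincombD s a b : lincomb s (a + b) = lincomb s a + lincomb s b.
Proof.
rewrite (lincombw s (msuppD_le a b)) (lincombw s (fsubsetUl _ (msupp b))).
rewrite (lincombw s (fsubsetUr (msupp a) _)) -big_split /=.
by apply: eq_bigr => j _; rewrite mcoeffD scalerDl.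
Qed.

Lemma lincombZ s x a : lincomb s (x *: a) = x *: lincomb s a.
Proof.
rewrite (lincombw s (msuppZ_le x a)) /lincomb scaler_sumr.
by apply: eq_bigr => j _; rewrite mcoeffZ scalerA.
Qed.

Lemma in_span_gen s j : in_span s (s j).
Proof.
exists << 1 *g j >>.
by rewrite (lincombw s msuppU_le) big_seq_fset1 mcoeffUU scale1r.
Qed.

Lemma in_span_sum s (T : Type) (r : seq T) (P : pred T) (x : T -> R) (u : T -> V) :
  (forall i, in_span s (u i)) -> in_span s (\sum_(i <- r | P i) x i *: u i).
Proof.
move=> su; apply: big_ind => [|_ _ [a ->] [b ->]|i _].
- by exists 0; rewrite /lincomb msupp0 big_seq_fset0.
- by exists (a + b); rewrite lincombD.
- by have [a ->] := su i; exists (x i *: a); rewrite lincombZ.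
Qed.

Lemma in_span_trans s (z : J -> V) u :
  (forall j, in_span s (z j)) -> in_span z u -> in_span s u.
Proof. by move=> sz [a ->]; apply: in_span_sum. Qed.

End Span.

Lemma linear_lincomb (R : nzRingType) (V W : lmodType R) (J : choiceType)
    (f : {linear V -> W}) (s : J -> V) a :
  lincomb (f \o s) a = f (lincomb s a).
Proof. by rewrite linear_sum; apply: eq_bigr => j _; rewrite linearZ. Qed.

Section Freezing.

Variables (I : finType) (q : flavour) (t : seed I).

Implicit Types (F : {set I}) (g h m : {ffun I -> int}).
Implicit Types (n : {ffun ufT t -> nat}) (s z : {ffun I -> int} -> LP q t).

Lemma pstarE (n : {ffun ufT t -> int}) i :
  pstar n i = \sum_(k : ufT t) bint t i (val k) * n k.
Proof.
rewrite /pstar sum_ffunE; apply: eq_bigr => k _; rewrite ffun_mulz; congr (_ * _).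
rewrite sum_ffunE (bigD1 i) //= ffun_mulz ffunE eqxx mul1r.
by rewrite big1 ?addr0 // => j ji; rewrite ffun_mulz ffunE eq_sym (negPf ji) mul0r.
Qed.

Lemma pstar_inj : is_seed t -> full_rank t -> injective (@pstar I t).
Proof.
move=> [_ _ bZ] rk n1 n2 e12.
have /row_fullP[L LB] : row_full (Btilde t) by apply/eqP.
pose u (k : 'I_#|uf t|) : ufT t := exist _ (enum_val k) (enum_valP k).
pose w (n : {ffun ufT t -> int}) : 'cV[rat]_(#|uf t|) := \col_k (n (u k))%:~R.
have BwE (n : {ffun ufT t -> int}) : Btilde t *m w n = \col_i (pstar n (enum_val i))%:~R.
  apply/colP => i; rewrite !mxE pstarE.
  pose r (k : ufT t) : 'I_#|uf t| := enum_rank_in (valP k) (val k).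
  have rK : cancel r u by move=> k; apply: val_inj; exact: enum_rankK_in (valP k).
  have uK : cancel u r by move=> k; exact: enum_valK_in.
  rewrite (reindex u) /=; last by exists r => k _; rewrite ?rK ?uK.
  rewrite rmorph_sum /=; apply: eq_bigr => k _; rewrite !mxE intrM /bint.
  by rewrite floorK //; apply: bZ; rewrite enum_valP orbT.
have : w n1 = w n2.
  by rewrite -[w n1]mul1mx -[w n2]mul1mx -LB -!mulmxA !BwE e12.
move=> /colP e; apply/ffunP => k.
have := e (enum_rank_in (valP k) (val k)); rewrite !mxE => /intr_inj.
suff -> : u (enum_rank_in (valP k) (val k)) = k by [].
by apply: val_inj; exact: enum_rankK_in (valP k).
Qed.

Lemma natv_inj : injective (@natv I t).
Proof. by move=> n1 n2 /ffunP e; apply/ffunP => k; have := e k; rewrite !ffunE => -[]. Qed.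

Lemma pstarD (n1 n2 : {ffun ufT t -> int}) : pstar (n1 + n2) = pstar n1 + pstar n2.
Proof.
apply/ffunP => i; rewrite ffunE !pstarE -big_split /=.
by apply: eq_bigr => k _; rewrite ffunE mulrDr.
Qed.

Definition addf n1 n2 : {ffun ufT t -> nat} := [ffun k => (n1 k + n2 k)%N].

Lemma pstar_addf n1 n2 :
  pstar (natv (addf n1 n2)) = pstar (natv n1) + pstar (natv n2).
Proof.
by rewrite -pstarD; congr pstar; apply/ffunP => k; rewrite !ffunE PoszD.
Qed.

Lemma avoids_addf F n1 n2 : avoids F (addf n1 n2) = avoids F n1 && avoids F n2.
Proof.
apply/forallP/andP => [H|[/forallP H1 /forallP H2] k].
  split; apply/forallP => k; apply/implyP => nk; have := H k.
  - by rewrite ffunE addn_eq0 negb_and nk.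
  - by rewrite ffunE addn_eq0 negb_and nk orbT.
rewrite ffunE addn_eq0 negb_and; apply/implyP => /orP[] nk.
- exact: implyP (H1 k) nk.
- exact: implyP (H2 k) nk.
Qed.

Lemma avoids0 n : avoids set0 n.
Proof. by apply/forallP => k; rewrite in_set0 implybT. Qed.

(* For [F = set0] this is the dominance order of the paper. *)
Definition dominates F g m : bool :=
  `[< exists2 n : {ffun ufT t -> nat}, avoids F n & m = g + pstar (natv n) >].

Definition is_pointed g (u : LP q t) : Prop :=
  u@_g = 1 /\ forall m, u@_m != 0 -> dominates set0 g m.

Lemma pstar_natv0 : pstar (natv (0 : {ffun ufT t -> nat})) = 0.
Proof. by apply/ffunP => i; rewrite pstarE ffunE big1 // => k _; rewrite !ffunE mulr0. Qed.

Lemma dominates_refl F g : dominates F g g.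
Proof.
apply/asboolP; exists (0 : {ffun ufT t -> nat}); last by rewrite pstar_natv0 addr0.
by apply/forallP => k; rewrite ffunE.
Qed.

Lemma dominates_trans F g h m : dominates F g h -> dominates F h m -> dominates F g m.
Proof.
move=> /asboolP[n1 a1 ->] /asboolP[n2 a2 ->]; apply/asboolP.
by exists (addf n1 n2); rewrite ?avoids_addf ?a1 // pstar_addf addrA.
Qed.

Lemma mcoeff_freezeE F g (u : LP q t) m :
  (freeze F g u)@_m = if dominates F g m then u@_m else 0.
Proof. exact: mcoeff_freeze. Qed.

Hypothesis p_inj : injective (fun n => pstar (natv n)).

Lemma dominates_split F g h m : dominates set0 g h -> dominates set0 h m ->
  dominates F g m = dominates F g h && dominates F h m.
Proof.
move=> /asboolP[n1 _ ->] /asboolP[n2 _ ->].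
apply/idP/andP => [/asboolP[n an]|[]]; last exact: dominates_trans.
rewrite -addrA -pstar_addf => /addrI/p_inj e.
move: an; rewrite -e avoids_addf => /andP[a1 a2].
split; apply/asboolP.
  by exists n1.
by exists n2; rewrite // pstar_addf addrA.
Qed.

Lemma dominates_anti g h : dominates set0 g h -> dominates set0 h g -> g = h.
Proof.
move=> /asboolP[n1 _ ->] /asboolP[n2 _ e].
suff -> : n1 = (0 : {ffun ufT t -> nat}) by rewrite pstar_natv0 addr0.
have : pstar (natv (addf n1 n2)) = pstar (natv (0 : {ffun ufT t -> nat})).
  by apply: (addrI g); rewrite pstar_addf addrA -e pstar_natv0 addr0.
move=> /p_inj/ffunP n0; apply/ffunP => k; have /eqP := n0 k.
by rewrite !ffunE addn_eq0 => /andP[/eqP].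
Qed.

Lemma pointed_is_pointed g (u : LP q t) : pointed g u -> is_pointed g u.
Proof.
have xE (a : base q) k m : (a *: xpow q t k)@_m = a *+ (k == m).
  by rewrite mcoeffZ mcoeffU mulrnAr mulr1.
move=> [c [c0 ->]]; split=> [|m].
  have g0 : g = g + pstar (natv (0 : {ffun ufT t -> nat})).
    by rewrite pstar_natv0 addr0.
  rewrite /expansion raddf_sum /= (big_fsetD1 0) /=; last first.
    by rewrite -mcoeff_neq0 c0 oner_neq0.
  rewrite xE -g0 eqxx c0 big1_fset ?addr0 // => n; rewrite in_fsetD1 => /andP[n0 _] _.
  rewrite xE; case: eqP => // e; case/eqP: n0.
  by apply: p_inj; apply: (addrI g); rewrite e.
rewrite /expansion raddf_sum /= => nz; apply: contraNT nz => /asboolP nd.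
apply/eqP/big1 => n _; rewrite xE; case: eqP => // e; case: nd.
by exists n; rewrite ?avoids0.
Qed.

Lemma freeze_is_pointed F g u : is_pointed g u -> is_pointed g (freeze F g u).
Proof.
move=> [u1 uP]; split=> [|m]; rewrite mcoeff_freezeE.
  by rewrite dominates_refl.
by case: ifP; rewrite ?eqxx // => _; exact: uP.
Qed.

(* Among the exponents violating [P], a maximal one would survive in the sum. *)
Lemma msupp_lincomb_pointed s (a : {malg base q[{ffun I -> int}]})
    (P : pred {ffun I -> int}) :
    (forall g, is_pointed g (s g)) ->
    (forall g h, P g -> dominates set0 g h -> P h) ->
    (forall m, (lincomb s a)@_m != 0 -> P m) ->
  forall j, j \in msupp a -> P j.
Proof.
move=> sP Pdown uP j.
pose above j := [fset k in msupp a | dominates set0 k j]%fset.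
have [N] := ubnP #|` above j|; elim: N j => // N IH j ltN ja.
apply: contraT => nPj.
have /negP[] : j \notin msupp a; last by [].
rewrite -mcoeff_eq0.
suff -> : a@_j = (lincomb s a)@_j by apply: contraNT nPj => /uP.
rewrite /lincomb raddf_sum /= (big_fsetD1 j) //= mcoeffZ (sP j).1 mulr1.
rewrite big1_fset ?addr0 // => k; rewrite in_fsetD1 => /andP[kj ka] _.
rewrite mcoeffZ; have [->|/(sP k).2 dkj] := eqVneq (s k)@_j 0; first by rewrite mulr0.
case/negP: nPj; apply: (Pdown k j _ dkj); apply: IH => //.
rewrite -ltnS (leq_trans _ ltN) // ltnS; apply: fproper_ltn_card; rewrite fproperE; apply/andP; split.
  apply/fsubsetP => l; rewrite !inE /= => /andP[-> dlk]; exact: dominates_trans dlk dkj.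
apply/fsubsetPn; exists j; rewrite !inE ja /=; first exact: dominates_refl.
by apply: contra kj => djk; rewrite (dominates_anti dkj djk).
Qed.

Lemma lincomb_pointed_eq0 s a :
  (forall g, is_pointed g (s g)) -> lincomb s a = 0 -> a = 0.
Proof.
move=> sP e; apply/malgP => j; rewrite mcoeff0; apply/eqP; rewrite mcoeff_eq0.
apply/negP => ja; suff: pred0 j by [].
apply: (msupp_lincomb_pointed sP _ _ ja) => // m.
by rewrite e mcoeff0 eqxx.
Qed.

Lemma freeze_lincomb F g s a :
    (forall h, is_pointed h (s h)) ->
    (forall h, h \in msupp a -> dominates set0 g h) ->
  freeze F g (lincomb s a) =
  \sum_(h <- msupp a | dominates F g h) a@_h *: freeze F h (s h).
Proof.
move=> sP ag; apply/malgP => m; rewrite mcoeff_freezeE /lincomb !raddf_sum /=.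
rewrite [RHS]big_mkcond /=.
transitivity (\sum_(h <- msupp a) if dominates F g m then a@_h * (s h)@_m else 0).
  by case: ifP => _; [apply: eq_bigr => h _; rewrite mcoeffZ | rewrite big1].
apply: eq_big_seq => h ha; rewrite mcoeffZ mcoeff_freezeE.
have [->|/(sP h).2 dhm] := eqVneq (s h)@_m 0; first by rewrite !if_same mulr0 !if_same.
rewrite (dominates_split F (ag h ha) dhm).
by case: (dominates F g h); case: (dominates F h m) => //=; rewrite mulr0.
Qed.

Lemma in_span_freeze F s (g : {ffun I -> int}) u :
    (forall h, is_pointed h (s h)) -> is_pointed g u ->
  in_span s u -> in_span (fun h => freeze F h (s h)) (freeze F g u).
Proof.
move=> sP [_ uP] [a uE]; rewrite uE in uP *; rewrite freeze_lincomb //.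
  by apply: in_span_sum => h; exact: in_span_gen.
apply: msupp_lincomb_pointed sP _ uP => h m; exact: dominates_trans.
Qed.

End Freezing.

Theorem theorem1p3 (q : flavour) (I : finType) (t0 : seed I) (F : {set I})
    (K : unitAlgType (base q)) (iota : {lrmorphism LP q t0 -> K})
    (z s : {ffun I -> int} -> LP q t0) :
  valid_seed q t0 ->
  F \subset uf t0 ->
  is_fraction_field iota ->
  full_rank t0 ->
  is_basis (upper_cluster_algebra iota) (fun g => iota (z g)) ->
  (forall g, pointed g (z g)) ->
  is_basis (@upper_cluster_algebra I q (freeze_seed F t0) K iota)
    (fun g => iota (freeze F g (z g))) ->
  is_basis (upper_cluster_algebra iota) (fun g => iota (s g)) ->
  (forall g, pointed g (s g)) ->
  is_basis (@upper_cluster_algebra I q (freeze_seed F t0) K iota)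
    (fun g => iota (freeze F g (s g))).
Proof.
move=> [seed_t _] _ [_ iota_inj _] rk [_ Uz] zp [_ Ufz] [_ Us] sp.
have p_inj : injective (fun n : {ffun ufT t0 -> nat} => pstar (natv n)).
  by move=> n1 n2 /(pstar_inj seed_t rk)/natv_inj.
have zP g := pointed_is_pointed p_inj (zp g).
have sP g := pointed_is_pointed p_inj (sp g).
have iota_span (f : {ffun I -> int} -> LP q t0) u :
    in_span (fun g => iota (f g)) (iota u) <-> in_span f u.
  split=> -[a e]; exists a; first by apply: iota_inj; rewrite e -linear_lincomb.
  by rewrite e -linear_lincomb.
have span_sub (f1 f2 : {ffun I -> int} -> LP q t0) :
    (forall g, is_pointed g (f1 g)) -> (forall g, is_pointed g (f2 g)) ->
    (forall u, in_span (fun g => iota (f1 g)) u -> in_span (fun g => iota (f2 g)) u) ->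
    forall u, in_span (fun g => iota (freeze F g (f1 g))) u ->
      in_span (fun g => iota (freeze F g (f2 g))) u.
  move=> f1P f2P sub u; apply: in_span_trans => g.
  apply/iota_span/in_span_freeze => //; apply/iota_span/sub.
  exact: (in_span_gen (fun g => iota (f1 g))).
split=> [a e|u].
  apply: (lincomb_pointed_eq0 p_inj) (fun g => freeze_is_pointed F (sP g)) _.
  by apply: iota_inj; rewrite -linear_lincomb rmorph0.
split=> [/Ufz|]; first by apply: span_sub => // v /Uz/Us.
move=> su; apply/Ufz; move: u su; apply: span_sub => // v /Us/Uz; exact.
Qed.
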